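(* Let $G$ be a connected $\Delta$-regular simple graph of order $n=2\Delta$. Let $k_3$ be the number of subsets of $V(G)$ of cardinality three that induce a connected subgraph of $G$. Then $G$ is isomorphic to the complete bipartite graph $K_{\Delta,\Delta}$ if and only if $k_3 = n\binom{\Delta}{2}$.
   Context: Graphs are finite, simple and have at least one vertex. The order of a graph is its number of vertices. *)

(* Defs.v *)
From mathcomp Require Import all_boot.
Set Implicit Arguments.
Unset Strict Implicit.
Unset Printing Implicit Defensive.

Record sgraph := SGraph {
  vertex :> finType;
  adj : rel vertex;
  adj_sym : symmetric adj;
  adj_irrefl : irreflexive adj
}.

Notation "x -- y" := (adj x y) (at level 30, no associativity).

Definition neighbours (G : sgraph) (x : G) : {set G} := [set y | x -- y].

Definition regular (G : sgraph) (d : nat) : Prop :=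
  forall x : G, #|neighbours x| = d.

(* Holds vacuously for the graph without vertices. *)
Definition connected (G : sgraph) : bool :=
  [forall x : G, forall y : G, connect (@adj G) x y].

Section Induced.
Variables (G : sgraph) (S : {set G}).

Definition induced_adj : rel {x : G | x \in S} := fun x y => val x -- val y.

Lemma induced_adj_sym : symmetric induced_adj.
Proof. by move=> x y; apply: adj_sym. Qed.

Lemma induced_adj_irrefl : irreflexive induced_adj.
Proof. by move=> x; apply: adj_irrefl. Qed.

Definition induced : sgraph := SGraph induced_adj_sym induced_adj_irrefl.
End Induced.

Definition connected_sets (G : sgraph) (k : nat) : {set {set G}} :=
  [set S : {set G} | (#|S| == k) && connected (induced S)].

Definition isomorphic (G H : sgraph) : Prop :=
  exists2 f : G -> H, bijective f & forall x y : G, (f x -- f y) = (x -- y).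

Section CompleteBipartite.
Variables m n : nat.

Definition bipartite_adj : rel ('I_m + 'I_n) := fun x y =>
  match x, y with
  | inl _, inr _ | inr _, inl _ => true
  | _, _ => false
  end.

Lemma bipartite_adj_sym : symmetric bipartite_adj.
Proof. by case=> i [] j. Qed.

Lemma bipartite_adj_irrefl : irreflexive bipartite_adj.
Proof. by case. Qed.

Definition complete_bipartite : sgraph :=
  SGraph bipartite_adj_sym bipartite_adj_irrefl.
End CompleteBipartite.

(* Main.v *)
Require Import Defs.
From mathcomp Require Import all_boot.
Set Implicit Arguments.
Unset Strict Implicit.
Unset Printing Implicit Defensive.

(** Each pair of neighbours of a vertex [x] forms with [x] a connected set of
    three vertices, and every such set arises in this way. There are
    [n * 'C(d, 2)] such cherries, so [k_3 = n * 'C(d, 2)] exactly when distinct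
    cherries have distinct vertex sets, i.e. when [G] has no triangle. In a
    triangle-free [d]-regular graph of order [2d], the neighbourhoods of
    adjacent vertices are disjoint, hence complementary. *)

Definition triangle_free (G : sgraph) : Prop :=
  forall x y z : G, x -- y -> x -- z -> ~~ (y -- z).

Lemma complete_bipartite_triangle_free m n :
  triangle_free (complete_bipartite m n).
Proof. by case=> ? [] ? [] ?. Qed.

Lemma isomorphic_triangle_free (G H : sgraph) :
  isomorphic G H -> triangle_free H -> triangle_free G.
Proof. by case=> f _ fE H_tf x y z; rewrite -!fE; apply: H_tf. Qed.

(** A path from [x] to [y] inside [S] is nonempty as [x != y], and its first edge leads to [z]. *)
Lemma induced_connected_neighbour (G : sgraph) (S : {set G}) (x y : G) :
  connected (induced S) -> x \in S -> y \in S -> x != y ->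
  exists2 z, z \in S & x -- z.
Proof.
move=> /forallP conS xS yS neq_xy.
have /forallP/(_ (Sub y yS))/connectP[[|z p] /=] := conS (Sub x xS).
  by move=> _ [eq_yx]; rewrite eq_yx eqxx in neq_xy.
by case/andP=> xz _ _; exists (val z) => //; apply: valP.
Qed.

Section Cherries.
Variable G : sgraph.
Implicit Types (x y z : G) (A S : {set G}) (p : G * {set G}).

(** The centre is recorded apart from the two leaves, so that a triangle carries three different
    cherries on one vertex set. *)
Definition cherries : {set G * {set G}} :=
  [set p : G * {set G} | (p.2 \subset neighbours p.1) && (#|p.2| == 2)].

Definition cherry_set p : {set G} := p.1 |: p.2.

Lemma card_cherries d : regular G d -> #|cherries| = #|G| * 'C(d, 2).
Proof.
move=> G_reg; rewrite -sum1_card.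
under eq_bigl do rewrite inE.
(* Count by centre: each [x] contributes the two-element subsets of its neighbourhood. *)
rewrite -(pair_big_dep xpredT
  (fun x A => (A \subset neighbours x) && (#|A| == 2)) (fun _ _ => 1)) /=.
rewrite -sum_nat_const; apply: eq_bigr => x _.
by rewrite -(G_reg x) -cards_draws -sum1_card; apply: eq_bigl => A; rewrite inE.
Qed.

Lemma centre_notin_cherry x A : (x, A) \in cherries -> x \notin A.
Proof.
rewrite inE /= => /andP[/subsetP sA _]; apply/negP => /sA.
by rewrite inE adj_irrefl.
Qed.

Lemma pair_cherry x y z :
  x -- y -> x -- z -> y != z -> (x, [set y; z]) \in cherries.
Proof.
move=> xy xz yz; rewrite inE /= cards2 yz eqxx andbT.
by apply/subsetP=> t /set2P[]->; rewrite inE.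
Qed.

Lemma cherry_set_connected p :
  p \in cherries -> cherry_set p \in connected_sets G 3.
Proof.
case: p => x A pC; have xA := centre_notin_cherry pC.
move: pC; rewrite !inE /= => /andP[/subsetP sA /eqP A2].
rewrite cardsU1 xA A2 eqxx /=; set S := cherry_set _.
have xS : x \in S by rewrite /S /cherry_set setU11.
pose c : induced S := Sub x xS.
(* Every vertex of the cherry is its centre or adjacent to it, so any two are joined through the
   centre. *)
have c_all (u : induced S) : connect (@adj (induced S)) c u.
  have /setU1P[ux|uA] := valP u; last by apply: connect1; have := sA _ uA; rewrite inE.
  by rewrite (_ : u = c) ?connect0 //; apply: val_inj.
have sym : connect_sym (@adj (induced S)).
  by apply: sym_connect_sym; apply: adj_sym.
apply/forallP => u; apply/forallP => v.
by apply: connect_trans (c_all v); rewrite sym.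
Qed.

(** Pick an edge [a -- b] inside [S]. The third vertex [c] has a neighbour in [S], which is [a] or
    [b]; that neighbour is the centre. *)
Lemma connected_set_cherry S :
  S \in connected_sets G 3 -> exists2 p, p \in cherries & S = cherry_set p.
Proof.
rewrite inE => /andP[/eqP S3 conS].
have [a aS] : exists a, a \in S by apply/card_gt0P; rewrite S3.
have Sa2 : #|S :\ a| = 2 by move: S3; rewrite (cardsD1 a) aS => -[].
have [b0 b0S] : exists b, b \in S :\ a by apply/card_gt0P; rewrite Sa2.
case/setD1P: b0S => b0a b0S; rewrite eq_sym in b0a.
have [b bS ab] := induced_connected_neighbour conS aS b0S b0a.
have neq_ab : a != b by apply: contraL ab => /eqP->; rewrite adj_irrefl.
have bSa : b \in S :\ a by rewrite !inE eq_sym neq_ab.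
have /eqP/cards1P[c cE] : #|S :\ a :\ b| = 1.
  by move: Sa2; rewrite (cardsD1 b) bSa => -[].
have SE : S = a |: (b |: [set c]) by rewrite -cE !setD1K.
have : c \in S :\ a :\ b by rewrite cE set11.
rewrite !inE => /and3P[cb ca cS].
have [z zS cz] := induced_connected_neighbour conS cS aS ca.
move: zS cz; rewrite SE !inE => /or3P[] /eqP-> cz; last by rewrite adj_irrefl in cz.
- exists (a, [set b; c]) => //.
  by apply: pair_cherry; rewrite 1?eq_sym // adj_sym.
- exists (b, [set a; c]); last by rewrite /cherry_set /= setUCA.
  by apply: pair_cherry; rewrite 1?eq_sym // adj_sym.
Qed.

Lemma imset_cherry_set : cherry_set @: cherries = connected_sets G 3.
Proof.
apply/setP => S; apply/imsetP/idP; last exact: connected_set_cherry.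
by case=> p pC ->; apply: cherry_set_connected.
Qed.

(** A triangle gives one vertex set from two centres. Conversely, if cherries with different centres
    share their vertex set, each centre is a leaf of the other, and the remaining vertex is a leaf
    of both: a triangle. *)
Lemma cherry_set_injP :
  {in cherries &, injective cherry_set} <-> triangle_free G.
Proof.
split=> [inj x y z xy xz | G_tf [x A] [y B] xA yB].
  apply/negP => yz.
  have neq (u v : G) : u -- v -> u != v.
    by apply: contraL => /eqP->; rewrite adj_irrefl.
  have yx : y -- x by rewrite adj_sym.
  have eqS : cherry_set (x, [set y; z]) = cherry_set (y, [set x; z]).
    by rewrite /cherry_set /= setUCA.
  have [eq_xy _] := inj _ _ (pair_cherry xy xz (neq _ _ yz))
                            (pair_cherry yx yz (neq _ _ xz)) eqS.
  by rewrite eq_xy adj_irrefl in xy.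
rewrite /cherry_set /= => eqS.
have xnA := centre_notin_cherry xA; have ynB := centre_notin_cherry yB.
have [eq_xy | neq_xy] := eqVneq x y.
  by subst y; rewrite -(setU1K xnA) eqS setU1K.
move: xA yB; rewrite !inE /= => /andP[/subsetP sA /eqP A2] /andP[/subsetP sB _].
have yA : y \in A.
  by have := setU11 y B; rewrite -eqS => /setU1P[yx|//]; rewrite yx eqxx in neq_xy.
have [z] : exists z, z \in A :\ y.
  by apply/card_gt0P; move: A2; rewrite (cardsD1 y) yA add1n => -[->].
case/setD1P => zy zA.
have zB : z \in B.
  have : z \in y |: B by rewrite -eqS setU1r.
  by case/setU1P => // eq_zy; rewrite eq_zy eqxx in zy.
have := sA _ yA; have := sA _ zA; have := sB _ zB; rewrite !inE => yz xz xy.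
by have := G_tf _ _ _ xy xz; rewrite yz.
Qed.

Lemma card_connected_sets3 d : regular G d ->
  #|connected_sets G 3| = #|G| * 'C(d, 2) <-> triangle_free G.
Proof.
move=> /card_cherries <-; rewrite -imset_cherry_set.
apply: iff_trans cherry_set_injP.
(* An image has as many elements as its finite domain exactly when the map is injective there. *)
by split=> [/eqP/imset_injP | /card_in_imset].
Qed.

End Cherries.

Lemma isomorphic_complete_bipartite (G : sgraph) m n (B : {set G}) :
    #|B| = m -> #|~: B| = n ->
    (forall x y : G, x -- y = ((x \in B) != (y \in B))) ->
  isomorphic G (complete_bipartite m n).
Proof.
move=> Bm Bn adjE.
(* The inverse isomorphism: the left side enumerates [B], the right side its complement. *)
pose g (u : 'I_m + 'I_n) : G := match u with
  | inl i => enum_val (cast_ord (esym Bm) i)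
  | inr j => enum_val (cast_ord (esym Bn) j)
  end.
have gB u : (g u \in B) = (if u is inl _ then true else false).
  case: u => i /=; first exact: enum_valP.
  by apply/negbTE; rewrite -in_setC; apply: enum_valP.
have g_inj : injective g.
  move=> u v eq_g; have := gB u; rewrite eq_g gB.
  by case: u v eq_g => i [] j //= /enum_val_inj/cast_ord_inj->.
have [f gK fK] : bijective g.
  by apply: inj_card_bij => //; rewrite card_sum !card_ord -(cardsC B) Bm Bn.
exists f; first by exists g.
by move=> x y; rewrite -{2}(fK x) -{2}(fK y) adjE !gB; case: (f x) (f y) => ? [].
Qed.

Lemma triangle_free_complete_bipartite (G : sgraph) d :
    0 < #|G| -> regular G d -> #|G| = 2 * d -> triangle_free G ->
  isomorphic G (complete_bipartite d d).
Proof.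
move=> G_gt0 G_reg G_order G_tf.
have cardNC (x : G) : #|~: neighbours x| = d.
  by apply/eqP; rewrite -(eqn_add2l d) -{1}(G_reg x) cardsC G_order mul2n addnn.
have neighboursC (x y : G) : x -- y -> neighbours y = ~: neighbours x.
  move=> xy; apply/eqP; rewrite eqEcard cardNC G_reg leqnn andbT.
  apply/subsetP => z; rewrite !inE => yz; apply/negP => xz.
  by have := G_tf _ _ _ xy xz; rewrite yz.
have /card_gt0P[x _] := G_gt0.
have [y] : exists y, y \in neighbours x.
  (* The degree is positive because the order [2 * d] is. *)
  by apply/card_gt0P; rewrite G_reg; move: G_gt0; rewrite G_order; case: (d).
rewrite inE => xy.
apply: (@isomorphic_complete_bipartite G d d (neighbours x)) => // u v.
have -> : u -- v = (v \in neighbours u) by rewrite inE.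
(* The sides are the neighbourhoods of the ends of the edge [x -- y]: a vertex [u] lies in one of
   them, so it is adjacent to [x] or to [y], and [neighboursC] shows that its neighbourhood is the
   other side. *)
have [ux | uNx] := boolP (u \in neighbours x).
  have xu : x -- u by rewrite inE in ux.
  by rewrite (neighboursC _ _ xu) in_setC; case: (v \in _).
have yu : y -- u by move: uNx; rewrite -in_setC -(neighboursC _ _ xy) inE.
by rewrite (neighboursC _ _ yu) (neighboursC _ _ xy) setCK; case: (v \in _).
Qed.

Theorem lemma29 (G : sgraph) (d : nat)
    (G_nonempty : 0 < #|G|)
    (G_connected : connected G)
    (G_regular : regular G d)
    (G_order : #|G| = 2 * d) :
  isomorphic G (complete_bipartite d d) <->
  #|connected_sets G 3| = #|G| * 'C(d, 2).
Proof.
apply: iff_trans (iff_sym (card_connected_sets3 G_regular)); split.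
  move/isomorphic_triangle_free; apply.
  exact: complete_bipartite_triangle_free.
exact: triangle_free_complete_bipartite.
Qed.
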